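(* Let $k$ be a field of characteristic $0$, let $m,n\ge 1$ be integers, and let $X_i=(x_{i1},\dots,x_{in})$, $1\le i\le m$, be arrays of variables $x_{ij}$, all independent over $k$. The field $k(X_1,\dots,X_m)_0^G$ is generated over $k$ by the elements $$q_r:=\operatorname{tr}(X_1^r)\,\operatorname{tr}(X_1^{-r}),\qquad r=1,\dots,\frac{n(n-1)}{2},$$ together with the elements $$q_s^{(i)}:=\operatorname{tr}(X_1^sX_i)\,\operatorname{tr}(X_1^{-s}X_i^{-1}),\qquad i=2,\dots,m,\quad s=0,\dots,n(n-1)-1.$$
   Context: $n$-tuples are operated on as if they were diagonal $n\times n$ matrices: products, inverses and integer powers are taken componentwise, and $\operatorname{tr}$ of an $n$-tuple is the sum of its entries. $k(X_1,\dots,X_m)_0$ is the subfield of $k(x_{11},x_{12},\dots,x_{mn})$ of rational functions homogeneous of degree $0$ in each array $X_i$ (the function field of $(\mathbb{P}^{n-1})^m$); equivalently, it is generated over $k$ by all ratios $x_{ij}/x_{il}$. The symmetric group $S_n$ acts on it by simultaneously permuting $x_{i1},\dots,x_{in}$ for each $i$ (the same permutation of the second index for all $i$); the group $T=\{1,\tau\}$ of order two acts by the $k$-automorphism $\tau(x_{ij})=x_{ij}^{-1}$ for all $i,j$. These actions commute, and $G:=S_n\times T$. *)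

(* Defs.v *)
From HB Require Import structures.
From mathcomp Require Import all_boot all_order all_algebra.
From mathcomp Require Import perm generic_quotient.
From mathcomp Require Import mpoly.

Set Implicit Arguments.
Unset Strict Implicit.
Unset Printing Implicit Defensive.

Import GRing.Theory.
Local Open Scope ring_scope.
Local Open Scope quotient_scope.

(* Multinomials indexes variables by ordinals, so the variable x_ij is numbered
   by the rank of the pair (i, j) in the enumeration of 'I_m * 'I_n. *)
Definition nvars (m n : nat) : nat := #|{: 'I_m * 'I_n}|.

Definition polys (k : fieldType) (m n : nat) : idomainType :=
  {mpoly k[nvars m n]}.

Definition ratfun (k : fieldType) (m n : nat) : fieldType :=
  {fraction (polys k m n)}.

Section RationalFunctions.
Variables (k : fieldType) (m n : nat).
Local Notation P := {mpoly k[nvars m n]}.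
Local Notation K := (ratfun k m n).
Local Notation tofrac := (@tofrac (polys k m n)).

Definition scal (c : k) : K := tofrac (c%:MP : P).

Definition var (i : 'I_m) (j : 'I_n) : K :=
  tofrac ('X_(enum_rank (i, j)) : P).

Definition tr (v : 'I_n -> K) : K := \sum_(j < n) v j.

Definition mdeg_in (i : 'I_m) (M : 'X_{1..nvars m n}) : nat :=
  (\sum_(j < n) M (enum_rank (i, j)))%N.

Definition homog_in (i : 'I_m) (d : nat) (p : P) : Prop :=
  forall M, M \in msupp p -> mdeg_in i M = d.

Definition homog0_in (i : 'I_m) (f : K) : Prop :=
  exists d (p q : P), [/\ homog_in i d p, homog_in i d q, q != 0
    & f = tofrac p / tofrac q].

Definition homog0 (f : K) : Prop := forall i : 'I_m, homog0_in i f.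

Definition eval (v : 'I_m -> 'I_n -> K) (p : P) : K :=
  mmap scal (fun l => v (enum_val l).1 (enum_val l).2) p.

(* Substitution x_ij := v i j in a rational function.  It does not depend on
   the choice of numerator and denominator, and is a morphism of k-algebras,
   when the v i j are algebraically independent over k (see substE); this is
   the case for the two substitutions used below. *)
Definition subst (v : 'I_m -> 'I_n -> K) (f : K) : K :=
  eval v \n_(repr f) / eval v \d_(repr f).

Definition sigma (s : 'S_n) : K -> K := subst (fun i j => var i (s j)).

Definition tau : K -> K := subst (fun i j => (var i j)^-1).

(* G = S_n x T, where the component [true : bool] stands for tau. *)
Definition gact (g : 'S_n * bool) (f : K) : K :=
  if g.2 then tau (sigma g.1 f) else sigma g.1 f.

Definition Ginvariant (f : K) : Prop := forall g : 'S_n * bool, gact g f = f.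

(* The subfield of K generated by S over k. *)
Inductive generated (S : K -> Prop) : K -> Prop :=
| gen_mem f : S f -> generated S f
| gen_scal c : generated S (scal c)
| gen_add f g : generated S f -> generated S g -> generated S (f + g)
| gen_opp f : generated S f -> generated S (- f)
| gen_mul f g : generated S f -> generated S g -> generated S (f * g)
| gen_inv f : generated S f -> generated S f^-1.

Lemma scal_is_zmod_morphism : zmod_morphism scal.
Proof. by move=> a b; rewrite /scal mpolyCB tofracB. Qed.

Lemma scal_is_monoid_morphism : monoid_morphism scal.
Proof.
by split=> [|a b]; [rewrite /scal tofrac1 | rewrite /scal mpolyCM tofracM].
Qed.

HB.instance Definition _ :=
  GRing.isZmodMorphism.Build k K scal scal_is_zmod_morphism.
HB.instance Definition _ :=
  GRing.isMonoidMorphism.Build k K scal scal_is_monoid_morphism.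

HB.instance Definition _ v := GRing.RMorphism.copy (eval v)
  (mmap scal (fun l => v (enum_val l).1 (enum_val l).2)).

Lemma eval_scal v c : eval v c%:MP = scal c.
Proof. exact: mmapC. Qed.

Lemma eval_var v i j : eval v 'X_(enum_rank (i, j)) = v i j.
Proof. by rewrite /eval mmapX mmap1U enum_rankK. Qed.

Lemma tofrac_repr (f : K) :
  f = tofrac \n_(repr f) / tofrac \d_(repr f).
Proof.
have d0 := denom_ratioP (repr f).
apply: (canRL (mulfK _)); first by rewrite tofrac_eq0.
rewrite -{1}[f]reprK; unlock FracField.tofrac.
rewrite -[LHS]FracField.pi_mul; apply/eqmodP; rewrite /= FracField.equivfE.
by rewrite /FracField.mulf !numden_Ratio ?mulf_neq0 ?oner_neq0 ?mulr1 // mulrC.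
Qed.

Lemma substE v (p q : P) : injective (eval v) -> q != 0 ->
  subst v (tofrac p / tofrac q) = eval v p / eval v q.
Proof.
move=> injv q0; set f := _ / _.
have nz (r : P) : r != 0 -> eval v r != 0.
  by move=> r0; rewrite -(rmorph0 (eval v)) (inj_eq injv).
have d0 : \d_(repr f) != 0 := denom_ratioP (repr f).
apply/eqP; rewrite /subst eqr_div ?nz // -!rmorphM.
have /eqP := tofrac_repr f; rewrite {1}/f eqr_div ?tofrac_eq0 //.
by rewrite -!tofracM tofrac_eq => /eqP <-.
Qed.

Section Subst.
Variable v : 'I_m -> 'I_n -> K.
Hypothesis injv : injective (eval v).

Let evnz (r : P) : r != 0 -> eval v r != 0.
Proof. by move=> r0; rewrite -(rmorph0 (eval v)) (inj_eq injv). Qed.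

Lemma subst_tofrac (p : P) : subst v (tofrac p) = eval v p.
Proof.
have := substE p injv (oner_neq0 _).
by rewrite tofrac1 rmorph1 !divr1.
Qed.

Lemma subst_scal c : subst v (scal c) = scal c.
Proof. by rewrite subst_tofrac eval_scal. Qed.

Lemma subst_var i j : subst v (var i j) = v i j.
Proof. by rewrite subst_tofrac eval_var. Qed.

Lemma subst_is_zmod_morphism : zmod_morphism (subst v).
Proof.
move=> f g; rewrite (tofrac_repr f) (tofrac_repr g).
have := denom_ratioP (repr f); have := denom_ratioP (repr g).
move: (\n_(repr f)) (\d_(repr f)) (\n_(repr g)) (\d_(repr g)) => a b c d d0 b0.
rewrite !substE // -!mulNr -tofracN !addf_div ?tofrac_eq0 ?evnz //.
by rewrite -!tofracM -tofracD substE ?mulf_neq0 // rmorphD !rmorphM rmorphN.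
Qed.

Lemma subst_is_monoid_morphism : monoid_morphism (subst v).
Proof.
split; first by rewrite -tofrac1 subst_tofrac rmorph1.
move=> f g; rewrite (tofrac_repr f) (tofrac_repr g).
have := denom_ratioP (repr f); have := denom_ratioP (repr g).
move: (\n_(repr f)) (\d_(repr f)) (\n_(repr g)) (\d_(repr g)) => a b c d d0 b0.
by rewrite mulf_div -!tofracM !substE ?mulf_neq0 // mulf_div !rmorphM.
Qed.

End Subst.

Lemma eval_inj v :
    (forall p : P, exists h : 'X_{1..nvars m n} -> 'X_{1..nvars m n},
     exists2 y : K, {in msupp p &, injective h}
     & forall M, M \in msupp p -> eval v 'X_[M] * y = tofrac 'X_[h M]) ->
  injective (eval v).
Proof.
move=> hv; apply: raddf_inj => p evp0; apply/eqP; apply: contraT => p0.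
have [h [y injh hy]] := hv p.
have eq0 : \sum_(M <- msupp p) p@_M *: 'X_[h M] = 0 :> P.
  apply/eqP; rewrite -tofrac_eq0; apply/eqP.
  rewrite -[RHS](mul0r y) -evp0 rmorph_sum mulr_suml /=.
  rewrite !big_seq; apply: eq_bigr => M Mp.
  rewrite -mul_mpolyC tofracM -hy // mulrA /eval mmapX //.
have /(congr1 (mcoeff (h (mlead p)))) := eq0.
rewrite mcoeff0 raddf_sum /= (bigD1_seq (mlead p)) ?mlead_supp ?msupp_uniq //=.
rewrite mcoeffZ mcoeffX eqxx mulr1 big_seq_cond big1 ?addr0 => [lc0|M].
  by have := mleadc_eq0 p; rewrite lc0 eqxx (negPf p0).
case/andP=> Mp neq; rewrite mcoeffZ mcoeffX.
by rewrite (inj_in_eq injh) ?mlead_supp // (negPf neq) mulr0.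
Qed.

Lemma evalX v M : eval v 'X_[M] =
  \prod_l v (enum_val l).1 (enum_val l).2 ^+ (M l).
Proof. by rewrite /eval mmapX. Qed.

Lemma tofracX M : tofrac 'X_[M] =
  \prod_(l < nvars m n) var (enum_val l).1 (enum_val l).2 ^+ (M l).
Proof.
rewrite mpolyXE_id rmorph_prod /=; apply: eq_bigr => l _.
by rewrite /var tofracXn -surjective_pairing enum_valK.
Qed.

Lemma eval_sigma_inj (s : 'S_n) : injective (eval (fun i j => var i (s j))).
Proof.
pose ren (u : 'S_n) (l : 'I_(nvars m n)) : 'I_(nvars m n) :=
  enum_rank ((enum_val l).1, u (enum_val l).2).
have renK (u w : 'S_n) : cancel u w -> cancel (ren u) (ren w).
  by move=> uK l; rewrite /ren !enum_rankK /= uK -surjective_pairing enum_valK.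
have rK := renK _ _ (permK s); have rKV := renK _ _ (permKV s).
apply: eval_inj => p.
exists (fun M => [multinom M (ren (s^-1)%g l) | l < nvars m n]); exists 1.
  move=> M1 M2 _ _ /mnmP eqM; apply/mnmP => l.
  by have := eqM (ren s l); rewrite !mnmE rK.
move=> M _; rewrite mulr1 evalX tofracX.
rewrite [RHS](reindex (ren s)) /=; last by exists (ren (s^-1)%g) => l _.
by apply: eq_bigr => l _; rewrite mnmE rK /ren enum_rankK.
Qed.

Lemma var_neq0 i j : var i j != 0.
Proof. by rewrite tofrac_eq0 -msupp_eq0 msuppX. Qed.

Lemma eval_tau_inj : injective (eval (fun i j => (var i j)^-1)).
Proof.
apply: eval_inj => p; pose B := msize p.
have ltB M l : M \in msupp p -> (M l <= B)%N.
  move=> Mp; apply: leq_trans (ltnW (msize_mdeg_lt Mp)).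
  by rewrite mdegE (bigD1 l) //= leq_addr.
exists (fun M => [multinom (B - M l)%N | l < nvars m n]).
exists (\prod_(l < nvars m n) var (enum_val l).1 (enum_val l).2 ^+ B).
  move=> M1 M2 M1p M2p /mnmP eqM; apply/mnmP => l.
  by have := eqM l; rewrite !mnmE => /(congr1 (subn B)); rewrite !subKn ?ltB.
move=> M Mp; rewrite evalX tofracX -big_split /=; apply: eq_bigr => l _.
by rewrite mnmE exprVn exprB ?unitfE ?var_neq0 ?ltB // mulrC.
Qed.

Lemma sigma_scal s c : sigma s (scal c) = scal c.
Proof. exact/subst_scal/eval_sigma_inj. Qed.

Lemma sigma_var s i j : sigma s (var i j) = var i (s j).
Proof. exact/subst_var/eval_sigma_inj. Qed.

Lemma tau_scal c : tau (scal c) = scal c.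
Proof. exact/subst_scal/eval_tau_inj. Qed.

Lemma tau_var i j : tau (var i j) = (var i j)^-1.
Proof. exact/subst_var/eval_tau_inj. Qed.

HB.instance Definition _ s := GRing.isZmodMorphism.Build K K (sigma s)
  (subst_is_zmod_morphism (@eval_sigma_inj s)).
HB.instance Definition _ s := GRing.isMonoidMorphism.Build K K (sigma s)
  (subst_is_monoid_morphism (@eval_sigma_inj s)).
HB.instance Definition _ := GRing.isZmodMorphism.Build K K tau
  (subst_is_zmod_morphism eval_tau_inj).
HB.instance Definition _ := GRing.isMonoidMorphism.Build K K tau
  (subst_is_monoid_morphism eval_tau_inj).

End RationalFunctions.

(* Main.v *)
Require Import Defs.
From HB Require Import structures.
From mathcomp Require Import all_boot all_order all_algebra.
From mathcomp Require Import perm generic_quotient zify mpoly.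

Set Implicit Arguments.
Unset Strict Implicit.
Unset Printing Implicit Defensive.

Import GRing.Theory.
Local Open Scope ring_scope.

(** Write t_a = x_1j / x_1l for a pair a = (j, l) with j != l, and u_a for the
    same ratio in another array.  Let N = n(n-1) be the number of such pairs and
    F the field generated by the q's.

    Expanding the products of traces, q_r - n is the r-th power sum of the t_a
    and q_s^(i) - n is the sum of the t_a^s u_a ([trace_pairE]).  As the family
    t is stable under inversion, the polynomial with roots t_a is palindromic up
    to sign, so Newton's identities recover it, hence all power sums of the
    t_a, from the first N/2 power sums ([F_power_sum_all]).  The t_a being
    distinct, Lagrange interpolation turns the N moments of u into
    u_a in F(t) ([subfield_interpolation]).  A function that is homogeneous of
    degree 0 in each array is a rational function of the ratios
    ([homog0_ratios]), so it lies in F(t).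

    It remains to see that an element of F(t) fixed by G lies in F. This is
    Galois theory: an automorphism of F(t) over F permutes the t_a and respects
    their multiplicative relations, that is, it acts on the root system A_(n-1),
    whose automorphisms are S_n x {1, -1} ([preserves_ratio]). The descent is
    done by hand ([descent]). The sum of a polynomial in the t_(r a) over all
    maps r from the set of pairs to itself lies in F, because it factors into
    power sums ([root_fun_sum]). Let D(r) be the product of the differences t_(r
    a) t_(r b) - t_(r c) over the triples with t_a t_b != t_c, where one more
    value, 1, fixed by r, is adjoined to the t_a. Then D(r) vanishes unless r
    preserves all relations, in which case D(r) = D(1), 1 being the identity map
    ([indicator_preserves], [indicator_const]). Summing D(r) p(r) = f D(r) q(r)
    over r, where f = p(1) / q(1) and both terms have been multiplied so that q
    is a norm, exhibits f as a quotient of two elements of F. *)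

(** * Subfields given by a predicate *)

(** A predicate rather than a type of elements: the fields met below are known
    only through membership, for which no decision procedure is at hand. *)
Record is_subfield (K : fieldType) (F : K -> Prop) : Prop := IsSubfield {
  subfield1 : F 1;
  subfieldB : forall x y, F x -> F y -> F (x - y);
  subfieldM : forall x y, F x -> F y -> F (x * y);
  subfieldV : forall x, F x -> F x^-1 }.

Section Subfield.
Variables (K : fieldType) (F : K -> Prop).
Hypothesis sfF : is_subfield F.

Lemma subfield0 : F 0.
Proof. by rewrite -(subrr 1); apply: subfieldB => //; apply: subfield1. Qed.

Lemma subfieldN x : F x -> F (- x).
Proof.
by move=> Fx; rewrite -sub0r; apply: subfieldB => //; exact: subfield0.
Qed.

Lemma subfieldD x y : F x -> F y -> F (x + y).
Proof.
move=> Fx Fy; rewrite -(opprK y); apply: subfieldB => //; exact: subfieldN.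
Qed.

Lemma subfield_div x y : F x -> F y -> F (x / y).
Proof. by move=> Fx Fy; apply: subfieldM => //; exact: subfieldV. Qed.

Lemma subfield_sum I (r : seq I) (P : pred I) (f : I -> K) :
  (forall i, P i -> F (f i)) -> F (\sum_(i <- r | P i) f i).
Proof.
by move=> Ff; apply: big_ind => //; [exact: subfield0|exact: subfieldD].
Qed.

Lemma subfield_prod I (r : seq I) (P : pred I) (f : I -> K) :
  (forall i, P i -> F (f i)) -> F (\prod_(i <- r | P i) f i).
Proof.
by move=> Ff; apply: big_ind => //; [exact: subfield1|exact: subfieldM].
Qed.

Lemma subfieldX x n : F x -> F (x ^+ n).
Proof.
move=> Fx; rewrite -[n]card_ord -prodr_const.
by apply: subfield_prod => i _.
Qed.

Lemma subfieldMn x n : F x -> F (x *+ n).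
Proof.
move=> Fx; rewrite -[n]card_ord -sumr_const.
by apply: subfield_sum => i _.
Qed.

Lemma subfield_coefM (p q : {poly K}) :
  (forall i, F p`_i) -> (forall i, F q`_i) -> forall i, F (p * q)`_i.
Proof.
by move=> Fp Fq i; rewrite coefM; apply: subfield_sum => j _; exact: subfieldM.
Qed.

Lemma subfield_coef_prod_XsubC I (r : seq I) (P : pred I) (f : I -> K) :
  (forall i, P i -> F (f i)) ->
  forall s, F (\prod_(i <- r | P i) ('X - (f i)%:P))`_s.
Proof.
move=> Ff; apply: (big_ind (fun p : {poly K} => forall s,
  F p`_s)) => [s||i Pi s].
- by rewrite coef1; apply: subfieldMn; exact: subfield1.
- exact: subfield_coefM.
- rewrite coefB coefX coefC; apply: subfieldB => //.
    by apply: subfieldMn; exact: subfield1.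
  by case: ifP => // _; [exact: Ff|exact: subfield0].
Qed.

End Subfield.

(** * Power sums of a family closed under inversion *)

Section PowerSums.
Variables (K : fieldType) (A : finType) (t : A -> K).

Definition power_sum r : K := \sum_a t a ^+ r.

(** The reciprocal polynomial is used instead of the product of the X - t a
    because its logarithmic derivative generates the power sums. *)
Definition recip_poly : {poly K} := \prod_a (1 - t a *: 'X).

Let cofactor a : {poly K} := \prod_(b | b != a) (1 - t b *: 'X).

Lemma recip_polyE a : recip_poly = (1 - t a *: 'X) * cofactor a.
Proof. by rewrite /recip_poly (bigD1 a). Qed.

(** Division by 1 - t a X is multiplication by a geometric series. *)
Lemma coef_cofactor a r :
  (cofactor a)`_r = \sum_(i < r.+1) t a ^+ i * recip_poly`_(r - i).
Proof.
elim: r => [|r IHr].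
  rewrite big_ord1 expr0 mul1r subnn (recip_polyE a) mulrBl mul1r coefB.
  by rewrite -scalerAl coefZ coefXM mulr0 subr0.
have -> : (cofactor a)`_r.+1 = recip_poly`_r.+1 + t a * (cofactor a)`_r.
  by rewrite (recip_polyE a) mulrBl mul1r coefB -scalerAl coefZ coefXM subrK.
rewrite IHr [RHS]big_ord_recl expr0 mul1r subn0; congr (_ + _).
by rewrite mulr_sumr; apply: eq_bigr => i _; rewrite mulrA -exprS.
Qed.

Lemma deriv_recip_poly : recip_poly^`() = - \sum_a t a *: cofactor a.
Proof.
rewrite /recip_poly -sumrN.
have derivP (s : seq A) : uniq s -> (\prod_(a <- s) (1 - t a *: 'X))^`() =
    \sum_(a <- s) - (t a *: \prod_(b <- s | b != a) (1 - t b *: 'X)).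
  elim: s => [|c s IHs] /=; first by rewrite !big_nil derivC.
  case/andP=> cs us; rewrite !big_cons derivM IHs // eqxx.
  rewrite derivB derivZ derivX derivC sub0r alg_polyC.
  congr (_ + _).
    rewrite mulNr mul_polyC; congr (- (_ *: _)).
    rewrite big_seq [RHS]big_seq_cond; apply: eq_bigl => b.
    by case: (boolP (b \in s)) => //= bs; apply/esym;
      apply: contraNneq cs => <-.
  rewrite mulr_sumr big_seq [RHS]big_seq; apply: eq_bigr => a as_.
  rewrite big_cons; case: (altP (c =P a)) => [ca|_];
    first by rewrite ca as_ in cs.
  by rewrite mulrN scalerAr.
by rewrite -big_enum derivP ?enum_uniq // big_enum; apply: eq_bigr => a _;
  rewrite big_enum_cond.
Qed.

(** Newton's identities: compare coefficients in the derivative, using the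
    geometric series for each cofactor. *)
Lemma newton_identity r : recip_poly`_r.+1 *+ r.+1 =
  - \sum_(i < r.+1) power_sum i.+1 * recip_poly`_(r - i).
Proof.
rewrite -coef_deriv deriv_recip_poly coefN coef_sum; congr (- _).
under eq_bigr => a _ do rewrite coefZ coef_cofactor mulr_sumr.
rewrite exchange_big; apply: eq_bigr => i _ /=.
by rewrite mulr_suml; apply: eq_bigr => a _; rewrite mulrA exprS.
Qed.

Lemma recip_poly0 : recip_poly`_0 = 1.
Proof.
rewrite /recip_poly -horner_coef0 horner_prod big1 // => a _.
by rewrite !hornerE subr0.
Qed.

Lemma size_recip_prod (s : seq A) :
  (size (\prod_(a <- s) (1 - t a *: 'X))%R <= (size s).+1)%N.
Proof.
elim: s => [|a s IHs]; first by rewrite big_nil size_poly1.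
rewrite big_cons (leq_trans (size_polyMleq _ _)) // -subn1 leq_subLR add1n.
apply: (leq_trans (leq_add (_ : _ <= 2)%N IHs)) => //.
rewrite (leq_trans (size_polyD _ _)) // geq_max size_poly1 size_polyN /=.
by rewrite (leq_trans (size_scale_leq _ _)) // size_polyX.
Qed.

Lemma coef_rev_prod_XsubC (s : seq A) r d : (r + d)%N = size s ->
  (\prod_(a <- s) (1 - t a *: 'X))`_r = (\prod_(a <- s) ('X - (t a)%:P))`_d.
Proof.
elim: s r d => [|a s IHs] r d /=.
  by rewrite !big_nil; case: r d => [|r] [|d].
rewrite !big_cons !mulrBl mul1r !coefB -scalerAl coefZ mul_polyC coefZ !coefXM.
case: r d => [|r] [|d] //=.
- rewrite add0n => -[sd]; rewrite (IHs 0 d) // mulr0.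
  rewrite [X in _ - _ * X]nth_default ?mulr0 //.
  by rewrite size_prod_XsubC sd.
- rewrite addn0 => -[sr]; rewrite (IHs r 0) ?addn0 // nth_default ?sub0r // sr.
  exact: size_recip_prod.
- rewrite addnS addSn => -[sz]; rewrite (IHs r.+1 d) ?addSn //.
  by rewrite (IHs r d.+1) ?addnS.
Qed.

Variable inv : A -> A.
Hypothesis invK : involutive inv.
Hypothesis tinv : forall a, t (inv a) = (t a)^-1.
Hypothesis t_neq0 : forall a, t a != 0.

(** Inverting the roots of a polynomial reverses its coefficients up to a
    scalar, here a sign because the family is stable under inversion. *)
Lemma recip_poly_palindromic : exists2 e : K, e = 1 \/ e = -1 &
  forall r d, (r + d)%N = #|A| -> recip_poly`_r = e * recip_poly`_d.
Proof.
pose e := \prod_a - (t a)^-1; exists e.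
  apply/pred2P; rewrite -sqrf_eq1 expr2 {2}/e (reindex_inj (inv_inj invK)) /=.
  rewrite -big_split /= big1 // => a _.
  by rewrite tinv mulrNN mulfV // invr_eq0.
have revE : \prod_a ('X - (t a)%:P) = e *: recip_poly.
  rewrite (reindex_inj (inv_inj invK)) /e /recip_poly -scaler_prod.
  apply: eq_bigr => a _; rewrite tinv scalerBr scalerA mulNr mulVf //.
  by rewrite !scaleNr scale1r opprK alg_polyC addrC.
move=> r d rd; rewrite [in LHS]/recip_poly -big_enum /=.
by rewrite (@coef_rev_prod_XsubC _ r d) -?cardE // -coefZ -revE big_enum.
Qed.

Variable F : K -> Prop.
Hypothesis sfF : is_subfield F.
Hypothesis char0 : [pchar K] =i pred0.
Hypothesis F_power_sum :
  forall r, (1 <= r)%N -> (r <= #|A| %/ 2)%N -> F (power_sum r).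

Let F_recip_low r : (r <= #|A| %/ 2)%N -> F recip_poly`_r.
Proof.
elim/ltn_ind: r => -[|r] IHr le_r; first by rewrite recip_poly0;
  exact: subfield1.
have r0 : r.+1%:R != 0 :> K by rewrite (pcharf0P _).1.
have -> : recip_poly`_r.+1 = recip_poly`_r.+1 *+ r.+1 / r.+1%:R.
  by rewrite -[X in X / _]mulr_natr mulfK.
apply: subfield_div => //; last by apply: subfieldMn => //; exact: subfield1.
rewrite newton_identity; apply: subfieldN => //; apply: subfield_sum => // i _.
apply: subfieldM => //.
  by apply: F_power_sum => //; apply: leq_trans le_r; rewrite ltn_ord.
apply: IHr; first by rewrite ltnS leq_subr.
by apply: leq_trans le_r; rewrite leqW // leq_subr.
Qed.

(** Newton's identities give the coefficients up to the middle one (dividing by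
    r + 1 needs characteristic 0); the symmetry of the coefficients gives the
    others. *)
Lemma F_recip_poly r : F recip_poly`_r.
Proof.
have [le_r|lt_r] := leqP r (#|A| %/ 2); first exact: F_recip_low.
have [e e1 pal] := recip_poly_palindromic.
have [le_r|gt_r] := leqP r #|A|; last first.
  rewrite nth_default; first exact: subfield0.
  apply: leq_trans gt_r; rewrite /recip_poly.
  by rewrite -big_enum /= cardE; exact: size_recip_prod.
rewrite (pal r (#|A| - r)%N) ?subnKC //; apply: subfieldM => //.
  by case: e1 => ->; [|apply: subfieldN => //]; exact: subfield1.
apply: F_recip_low; lia.
Qed.

(** Newton's identities, now solved for the power sum of highest index, whose
    coefficient is the constant term 1. *)
Lemma F_power_sum_all r : F (power_sum r).
Proof.
elim/ltn_ind: r => -[_|r IHr].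
  apply: subfield_sum => // a _; rewrite expr0; exact: subfield1.
have -> : power_sum r.+1 = - (recip_poly`_r.+1 *+ r.+1) -
    \sum_(i < r) power_sum i.+1 * recip_poly`_(r - i).
  by rewrite newton_identity opprK big_ord_recr /= subnn recip_poly0 mulr1
    addrAC subrr add0r.
apply: subfieldB => //.
  by apply: subfieldN => //; apply: subfieldMn => //; exact: F_recip_poly.
apply: subfield_sum => // i _; apply: subfieldM => //; last exact: F_recip_poly.
by apply: IHr; rewrite ltnS.
Qed.

End PowerSums.

(** * Interpolation *)

(** Pairing the moments with the coefficients of the Lagrange polynomial that
    vanishes at all t b with b != a isolates u a. *)
Lemma subfield_interpolation (K : fieldType) (L : K -> Prop) (A : finType)
    (t u : A -> K) : is_subfield L -> injective t -> (forall a, L (t a)) ->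
    (forall s, (s < #|A|)%N -> L (\sum_a t a ^+ s * u a)) ->
  forall a, L (u a).
Proof.
move=> sfL injt Lt Lmoment a.
pose l : {poly K} := \prod_(b | b != a) ('X - (t b)%:P).
have Ll s : L l`_s by exact: subfield_coef_prod_XsubC.
have size_l : (size l <= #|A|)%N.
  rewrite /l -big_filter size_prod_XsubC -sum1_size big_filter sum1_card.
  rewrite (cardC1 a) prednK //; apply/card_gt0P; by exists a.
have l_eq0 b : b != a -> l.[t b] = 0.
  by move=> ba; rewrite /l horner_prod (bigD1 b) //= !hornerE subrr mul0r.
have l_neq0 : l.[t a] != 0.
  rewrite /l horner_prod prodf_seq_neq0; apply/allP => b _; apply/implyP => ba.
  by rewrite !hornerE subr_eq0 (inj_eq injt) eq_sym.
suff -> : u a = (\sum_(s < #|A|) l`_s * \sum_b t b ^+ s * u b) / l.[t a].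
  apply: subfield_div => //.
    by apply: subfield_sum => // s _; apply: subfieldM => //; exact: Lmoment.
  rewrite horner_coef; apply: subfield_sum => // s _; apply: subfieldM => //.
  exact: subfieldX.
apply: (canRL (mulfK l_neq0)).
under [RHS]eq_bigr => s _ do rewrite mulr_sumr.
rewrite exchange_big (bigD1 a) //= [X in _ + X]big1 ?addr0 => [|b ba].
  rewrite (horner_coef_wide _ size_l) mulrC mulr_suml.
  by apply: eq_bigr => s _; rewrite mulrA.
under eq_bigr => s _ do rewrite mulrA.
by rewrite -mulr_suml -horner_coef_wide // l_eq0 // mul0r.
Qed.

(** * Multiplicative relations in a finite family *)

Section Relations.
Variables (K : fieldType) (A : finType) (t : A -> K).

(** Adjoining the value 1 lets a single kind of relation, x y = z, express
    equality (1 t_a = t_b) and inverses (t_a t_b = 1) as well. *)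
Definition unit_ext (b : option A) : K := oapp t 1 b.

Definition triple : finType := (option A * option A * option A)%type.

Definition holds_at (w : triple) : bool :=
  unit_ext w.1.1 * unit_ext w.1.2 == unit_ext w.2.

Definition move (r : A -> A) (w : triple) : triple :=
  (omap r w.1.1, omap r w.1.2, omap r w.2).

Definition preserves (r : {ffun A -> A}) : bool :=
  [forall w, holds_at (move r w) == holds_at w].

Lemma preservesE (r : {ffun A -> A}) :
  reflect (forall w, holds_at (move r w) = holds_at w) (preserves r).
Proof. exact: eqfunP. Qed.

Definition fcomp (r s : {ffun A -> A}) : {ffun A -> A} := [ffun a => r (s a)].

Lemma move_comp (r s : {ffun A -> A}) w :
  move (fcomp r s) w = move r (move s w).
Proof.
by case: w => -[[a|] [b|]] [c|]; rewrite /move /= ?ffunE.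
Qed.

(** Up to a nonzero factor, the indicator function of [preserves], written as a
    polynomial in the t (r a). *)
Definition indicator (r : {ffun A -> A}) : K :=
  \prod_(w | ~~ holds_at w)
    (unit_ext (omap r w.1.1) * unit_ext (omap r w.1.2) - unit_ext (omap r w.2)).

Lemma indicator_neq0 (r : {ffun A -> A}) :
  (indicator r != 0) = [forall w, ~~ holds_at w ==> ~~ holds_at (move r w)].
Proof.
apply/idP/forallP => [r0 w|r0].
  apply/implyP => Nw; apply: contraNN r0 => /eqP rw.
  by rewrite /indicator (bigD1 w) //= rw subrr mul0r.
rewrite /indicator prodf_seq_neq0; apply/allP => w _; apply/implyP => Nw.
by rewrite subr_eq0; have /implyP := r0 w; exact.
Qed.

Hypothesis injt : injective t.

Lemma move_inj (r : A -> A) : injective r -> injective (move r).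
Proof.
move=> injr [[a b] c] [[a' b'] c'] [].
by do 3!move/(inj_omap injr) ->.
Qed.

(** The relation 1 t_a = t_b forces a = b, so reflecting it is injectivity. *)
Lemma reflects_inj (r : {ffun A -> A}) :
  (forall w, holds_at (move r w) -> holds_at w) -> injective r.
Proof.
move=> hr a b rab; apply: injt; apply/eqP.
by have := hr (None, Some a, Some b); rewrite /holds_at /= !mul1r rab; apply.
Qed.

Lemma preserves_inj r : preserves r -> injective r.
Proof. by move/preservesE=> hr; apply: reflects_inj => w; rewrite hr. Qed.

(** A map that sends non-relations to non-relations permutes the finite set of
    non-relations, hence also permutes the relations. *)
Lemma indicator_preserves r : (indicator r != 0) = preserves r.
Proof.
rewrite indicator_neq0; apply/forallP/preservesE => [hr|hr w];
  last by rewrite hr implybb.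
have hr' w : holds_at (move r w) -> holds_at w.
  by apply: contraLR; have /implyP := hr w.
have injm := move_inj (reflects_inj hr').
pose N := [set w | ~~ holds_at w].
have mN : move r @: N = N.
  apply/eqP; rewrite eqEcard card_imset // leqnn andbT.
  apply/subsetP => _ /imsetP[w + ->]; rewrite !inE.
  by have /implyP := hr w.
move=> w; apply/idP/idP; first exact: hr'.
apply: contraTT => Nmw; have : move r w \in N by rewrite inE.
by rewrite -mN mem_imset // inE.
Qed.

Lemma preserves1 : preserves [ffun a => a].
Proof.
apply/preservesE => -[[a b] c].
by congr holds_at; case: a b c => [a|] [b|] [c|]; rewrite /move /= ?ffunE.
Qed.

Lemma preserves_comp r s : preserves r -> preserves (fcomp r s) = preserves s.
Proof.
move/preservesE=> hr; apply/preservesE/preservesE => hs w.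
  by rewrite -(hs w) move_comp hr.
by rewrite move_comp hr.
Qed.

Lemma indicator_const r : preserves r -> indicator r = indicator [ffun a => a].
Proof.
move=> hr; have injm := move_inj (preserves_inj hr).
rewrite {2}/indicator (reindex_inj injm) /=.
apply: eq_big => [w|w _]; first by move/preservesE: hr => ->.
have E b : omap [ffun a => a] (omap r b) = omap r b by case: b => //= a;
  rewrite ffunE.
by rewrite !E.
Qed.

End Relations.

(** * Descent *)

Section Descent.
Variables (K : fieldType) (F : K -> Prop) (A : finType) (t : A -> K).
Hypothesis sfF : is_subfield F.

(** The polynomials over F in the t (r a), as functions of the map r.  All maps
    r are allowed, not only the permutations: this makes the sum over r of a
    monomial factor into power sums. *)
Inductive root_fun : ({ffun A -> A} -> K) -> Prop :=
| root_fun_const c : F c -> root_fun (fun _ => c)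
| root_fun_root a : root_fun (fun r => t (r a))
| root_funD f g : root_fun f -> root_fun g -> root_fun (fun r => f r + g r)
| root_funM f g : root_fun f -> root_fun g -> root_fun (fun r => f r * g r)
| root_fun_ext f g : f =1 g -> root_fun f -> root_fun g.

Lemma root_funN f : root_fun f -> root_fun (fun r => - f r).
Proof.
move=> rf; apply: (@root_fun_ext (fun r => -1 * f r)) => [r|];
  first by rewrite mulN1r.
by apply: root_funM => //; apply: root_fun_const; apply: subfieldN => //;
  exact: subfield1.
Qed.

Lemma root_fun_prod I (s : seq I) (P : pred I) (f : I -> {ffun A -> A} -> K) :
  (forall i, P i -> root_fun (f i)) ->
  root_fun (fun r => \prod_(i <- s | P i) f i r).
Proof.
move=> rf; elim: s => [|i s IHs].
  apply: (@root_fun_ext (fun _ => 1)) => [r|]; first by rewrite big_nil.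
  by apply: root_fun_const; exact: subfield1.
case: (boolP (P i)) => Pi; last first.
  by apply: root_fun_ext IHs => r; rewrite big_cons (negPf Pi).
apply: (@root_fun_ext (fun r => f i r * \prod_(j <- s | P j) f j r)) => [r|].
  by rewrite big_cons Pi.
by apply: root_funM => //; exact: rf.
Qed.

Lemma root_fun_comp f s : root_fun f -> root_fun (fun r => f (fcomp r s)).
Proof.
elim=> [c Fc|a|f1 f2 _ ? _ ?|f1 f2 _ ? _ ?|f1 f2 eqf _ rf].
- exact: root_fun_const.
- by apply: root_fun_ext (root_fun_root (s a)) => r; rewrite ffunE.
- exact: root_funD.
- exact: root_funM.
- by apply: root_fun_ext rf => r.
Qed.

Lemma root_fun_indicator : root_fun (indicator t).
Proof.
apply: root_fun_prod => w _.
have rB (b : option A) : root_fun (fun r => unit_ext t (omap r b)).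
  case: b => [a|] /=; first exact: root_fun_root.
  by apply: root_fun_const; exact: subfield1.
apply: root_funD; last exact: root_funN.
exact: root_funM.
Qed.

Hypothesis F_power_sum : forall r, F (power_sum t r).

(** Products of generators are handled by proving, by induction on f, that
    multiplication by f preserves the property that the sum against every
    monomial lies in F. *)
Lemma root_fun_sum f : root_fun f -> F (\sum_r f r).
Proof.
pose good g := forall e : A -> nat,
    F (\sum_(r : {ffun A -> A}) g r * \prod_a t (r a) ^+ e a).
have good1 : good (fun _ => 1).
  move=> e; under eq_bigr do rewrite mul1r.
  rewrite -(bigA_distr_bigA (fun a b => t b ^+ e a)).
  by apply: subfield_prod => // a _; exact: F_power_sum.
have goodM h : root_fun h -> forall g, good g -> good (fun r => h r * g r).
  elim=> [c Fc|a|h1 h2 _ IH1 _ IH2|h1 h2 _ IH1 _ IH2|h1 h2 eqh _ IH] g gg e.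
  - under eq_bigr do rewrite -mulrA.
    by rewrite -mulr_sumr; apply: subfieldM.
  - have := gg (fun b => (b == a) + e b)%N; congr F; apply: eq_bigr => r _.
    under eq_bigr do rewrite exprD.
    rewrite big_split /= (bigD1 a) //= eqxx expr1 big1 => [|b /negPf->] //.
    by rewrite mulr1 mulrCA mulrA.
  - under eq_bigr do rewrite mulrDl mulrDl.
    by rewrite big_split; apply: subfieldD => //; [exact: IH1|exact: IH2].
  - under eq_bigr do rewrite -(mulrA (h1 _)).
    by apply: IH1; exact: IH2.
  - by under eq_bigr do rewrite -eqh; exact: IH.
move=> rf; have := goodM _ rf _ good1 (fun _ => 0%N).
by congr F; apply: eq_bigr => r _; rewrite mulr1 big1 ?mulr1.
Qed.

Definition root_ratio (f : K) : Prop := exists p q,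
  [/\ root_fun p, root_fun q, q [ffun a => a] != 0 &
      f = p [ffun a => a] / q [ffun a => a]].

Lemma root_ratio_sub f : F f -> root_ratio f.
Proof.
move=> Ff; exists (fun _ => f), (fun _ => 1).
split; [exact: root_fun_const| |exact: oner_neq0|by rewrite divr1].
by apply: root_fun_const; exact: subfield1.
Qed.

Lemma root_ratio_root a : root_ratio (t a).
Proof.
exists (fun r => t (r a)), (fun _ => 1).
split; [exact: root_fun_root| |exact: oner_neq0|by rewrite divr1 ffunE].
by apply: root_fun_const; exact: subfield1.
Qed.

Lemma root_ratio_subfield : is_subfield root_ratio.
Proof.
split.
- by apply: root_ratio_sub; exact: subfield1.
- move=> _ _ [p [q [rp rq q0 ->]]] [p' [q' [rp' rq' q'0 ->]]].
  exists (fun r => p r * q' r + (- p' r) * q r), (fun r => q r * q' r); split.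
  + by apply: root_funD; apply: root_funM => //; exact: root_funN.
  + exact: root_funM.
  + by rewrite mulf_neq0.
  + by rewrite -mulNr addf_div.
- move=> _ _ [p [q [rp rq q0 ->]]] [p' [q' [rp' rq' q'0 ->]]].
  exists (fun r => p r * p' r), (fun r => q r * q' r).
  by split;
    [exact: root_funM|exact: root_funM|rewrite mulf_neq0|rewrite mulf_div].
- move=> _ [p [q [rp rq q0 ->]]]; rewrite invf_div.
  have [p0|p0] := eqVneq (p [ffun a => a]) 0; last by exists q, p.
  by rewrite p0 invr0 mulr0; apply: root_ratio_sub; exact: subfield0.
Qed.

Hypothesis injt : injective t.
Hypothesis char0 : [pchar K] =i pred0.

(** If f = p / q, the equation f q(r) = p(r) holds at every r that preserves the
    relations, because such an r comes from an automorphism fixing f.  Weighting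
    by [indicator] extends it to all r, so it can be summed.  The sum on the
    left must not vanish: q is first multiplied by its conjugates, which makes
    it constant on the relevant r, and characteristic 0 is used to count
    them. *)
Theorem descent f :
    (forall r, preserves t r -> exists s : {rmorphism K -> K},
       [/\ forall c, F c -> s c = c, forall a, s (t a) = t (r a) & s f = f]) ->
  root_ratio f -> F f.
Proof.
move=> hf [p [q [rp rq q0 fpq]]].
pose id_ : {ffun A -> A} := [ffun a => a].
have conj r : preserves t r -> exists s : {rmorphism K -> K}, s f = f /\
    forall g, root_fun g -> s (g id_) = g r.
  case/hf=> s [sF st sf]; exists s; split=> // g.
  elim=> [c Fc|a|h1 h2 _ IH1 _ IH2|h1 h2 _ IH1 _ IH2|h1 h2 eqh _ IH].
  - exact: sF.
  - by rewrite ffunE st.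
  - by rewrite rmorphD IH1 IH2.
  - by rewrite rmorphM IH1 IH2.
  - by rewrite -!eqh.
pose stab : pred {ffun A -> A} := preserves t.
pose cofactor r := \prod_(s | stab s && (s != id_)) q (fcomp r s).
pose norm r := q r * cofactor r.
have fcomp1 r : fcomp r id_ = r by apply/ffunP => a; rewrite !ffunE.
have normE r : norm r = \prod_(s | stab s) q (fcomp r s).
  by rewrite (bigD1 id_) ?[stab _]preserves1 //= fcomp1.
have rnorm : root_fun norm.
  by apply: root_funM => //; apply: root_fun_prod => s _; exact: root_fun_comp.
have fcomp1l r : fcomp id_ r = r by apply/ffunP => a; rewrite !ffunE.
have norm_neq0 : norm id_ != 0.
  rewrite normE prodf_seq_neq0; apply/allP => s _; apply/implyP.
  move=> /conj[g [_ gE]].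
  by rewrite fcomp1l -gE // fmorph_eq0.
have norm_const r : stab r -> norm r = norm id_.
  move=> hr; have injr := preserves_inj injt hr.
  have injc : injective (fcomp r).
    move=> s s' /ffunP ss; apply/ffunP => a; have := ss a.
    by rewrite !ffunE => /injr.
  rewrite !normE [RHS](reindex_inj injc) /=.
  apply: eq_big => [s|s _]; first exact/esym/preserves_comp.
  by rewrite fcomp1l.
have fE r : stab r -> p r * cofactor r = f * norm r.
  case/conj=> s [sf sE]; rewrite mulrA; congr (_ * _).
  by rewrite -(sE p) // -(sE q) // -{1}sf -rmorphM fpq divfK.
pose ind := indicator t.
have ind0 r : ~~ stab r -> ind r = 0.
  by rewrite /stab -indicator_preserves // negbK => /eqP.
pose S := \sum_r ind r * norm r.
have S_neq0 : S != 0.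
  rewrite /S (bigID stab) /= [X in _ + X]big1 ?addr0; last first.
    by move=> r /ind0 ->; rewrite mul0r.
  rewrite (eq_bigr (fun _ => ind id_ * norm id_)) => [|r hr]; last first.
    by rewrite /ind indicator_const // norm_const.
  have ind_neq0 : ind id_ != 0 by rewrite /ind indicator_preserves //
    preserves1.
  have term_neq0 : ind id_ * norm id_ != 0 by exact: mulf_neq0.
  rewrite sumr_const -mulr_natr; apply: mulf_neq0 => //.
  rewrite (pcharf0P _).1 // -lt0n; apply/card_gt0P; exists id_.
  exact: preserves1.
have -> : f = (\sum_r ind r * (p r * cofactor r)) / S.
  apply: (canRL (mulfK S_neq0)); rewrite mulr_sumr; apply: eq_bigr => r _.
  case: (boolP (stab r)) => [/fE ->|/ind0->]; last by rewrite !mul0r mulr0.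
  by rewrite mulrCA.
have rind := root_fun_indicator.
apply: subfield_div => //; apply: root_fun_sum; apply: root_funM => //.
by apply: root_funM => //; apply: root_fun_prod => s _; exact: root_fun_comp.
Qed.

End Descent.

(** * Multihomogeneous rational functions *)

Section Homogeneous.
Variables (k : fieldType) (m n : nat).
Local Notation P := {mpoly k[nvars m n]}.
Local Notation K := (ratfun k m n).
Local Notation tofrac := (@FracField.tofrac (polys k m n)).
Local Notation var := (@var k m n).
Local Notation scal := (@scal k m n).

(** [grade i] substitutes x_ij T for x_ij (T the new polynomial variable), so
    that the coefficient of T^e is the component of degree e in the i-th array;
    being a ring morphism, it makes components of products computable. *)
Definition grade_var (i : 'I_m) (l : 'I_(nvars m n)) : {poly P} :=
  ('X_l)%:P * 'X^((enum_val l).1 == i).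

Definition grade (i : 'I_m) (p : P) : {poly P} :=
  mmap (polyC \o @mpolyC (nvars m n) k) (grade_var i) p.

HB.instance Definition _ i := GRing.RMorphism.copy (grade i)
  (mmap (polyC \o @mpolyC (nvars m n) k) (grade_var i)).

Lemma prod_vars (R : comNzRingType) (F : 'I_(nvars m n) -> R) :
  \prod_l F l = \prod_i \prod_j F (enum_rank (i, j)).
Proof.
rewrite pair_bigA /= (reindex _ (onW_bij _ (@enum_rank_bij _))) /=.
by apply: eq_bigr => -[i j].
Qed.

Lemma grade_monomial i M : grade i 'X_[M] = ('X_[M])%:P * 'X^(mdeg_in i M).
Proof.
rewrite /grade mmapX /mmap1 /grade_var.
under eq_bigr => l _ do rewrite exprMn -exprM -rmorphXn /=.
rewrite big_split /= -rmorph_prod -mpolyXE_id; congr (_ * _).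
rewrite prod_vars (bigD1 i) //= [X in _ * X]big1 ?mulr1; last first.
  by move=> i' ne; apply: big1 => j _; rewrite enum_rankK /= (negPf ne).
under eq_bigr => j _ do rewrite enum_rankK eqxx mul1n.
by rewrite -expr_sum.
Qed.

Lemma coef_grade i (p : P) e M :
  ((grade i p)`_e)@_M = p@_M *+ (mdeg_in i M == e).
Proof.
have gradeE : grade i p =
    \sum_(N <- msupp p) (p@_N *: 'X_[N])%:P * 'X^(mdeg_in i N).
  rewrite {1}(mpolyE p) rmorph_sum; apply: eq_bigr => N _ /=.
  rewrite -mul_mpolyC rmorphM /= grade_monomial polyCM mulrA.
  by congr (_ * _ * _); rewrite /grade mmapC.
rewrite gradeE coef_sum raddf_sum /= [in RHS](mpolyE p) raddf_sum /= -sumrMnl.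
apply: eq_bigr => N _; rewrite coefCM coefXn mulr_natr mcoeffMn !mcoeffZ
  mcoeffX.
by case: (eqVneq N M) => [->|_]; rewrite ?mulr0 ?mul0rn // eq_sym.
Qed.

Lemma grade_homog i d (p : P) : homog_in i d p -> grade i p = p%:P * 'X^d.
Proof.
move=> hp; apply/polyP => e; rewrite coefCM coefXn mulr_natr.
apply/mpolyP => M; rewrite coef_grade mcoeffMn eq_sym.
have [/hp ->|/memN_msupp_eq0 ->] := boolP (M \in msupp p); first by [].
by rewrite !mul0rn.
Qed.

Lemma homog_in_coef_grade i (p : P) e : homog_in i e (grade i p)`_e.
Proof.
move=> M; rewrite mcoeff_msupp coef_grade.
by case: (mdeg_in i M =P e) => // _; rewrite mulr0n eqxx.
Qed.

Lemma msupp_coef_grade i (p : P) e : {subset msupp (grade i p)`_e <= msupp p}.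
Proof.
move=> M; rewrite !mcoeff_msupp coef_grade.
by case: (p@_M =P 0) => // ->; rewrite mul0rn eqxx.
Qed.

(** Homogeneity is assumed for each array with its own fraction a / b.  From
    p b = a q, the components of equal degree satisfy p_e b = a q_e, so p / q
    may be replaced by p_e / q_e.  Taking components only removes monomials, so
    what was gained for other arrays is kept. *)
Lemma multihomogeneous_fraction (f : K) : homog0 f -> exists p q : P,
  [/\ q != 0, f = tofrac p / tofrac q &
      forall i, exists d, homog_in i d p /\ homog_in i d q].
Proof.
move=> hf; suff [p [q [q0 -> hpq]]] : exists p q : P, [/\ q != 0,
    f = tofrac p / tofrac q & forall i, i \in enum 'I_m ->
    exists d, homog_in i d p /\ homog_in i d q].
  by exists p, q; split=> // i; apply: hpq; rewrite mem_enum.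
elim: (enum 'I_m) => [|i s [p [q [q0 fpq hpq]]]].
  exists \n_(generic_quotient.repr f), \d_(generic_quotient.repr f); split=> //.
    exact: denom_ratioP.
  exact: tofrac_repr.
have [d [a [b [ha hb b0 fab]]]] := hf i.
have pbaq : p * b = a * q.
  have /eqP := fpq; rewrite fab eqr_div ?tofrac_eq0 // -!tofracM tofrac_eq.
  by move/eqP.
have [M qM] : exists M, M \in msupp q.
  by exists (mlead q); exact: mlead_supp.
pose e := mdeg_in i M.
have qe0 : (grade i q)`_e != 0.
  apply: contraTneq qM => /(congr1 (mcoeff M)); rewrite coef_grade eqxx mcoeff0.
  by rewrite mcoeff_msupp negbK => /eqP.
exists (grade i p)`_e, (grade i q)`_e; split=> //.
  rewrite fab; apply/eqP; rewrite eqr_div ?tofrac_eq0 // -!tofracM tofrac_eq.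
  have /(congr1 (grade i)) := pbaq; rewrite !rmorphM /= (grade_homog ha)
    (grade_homog hb).
  rewrite mulrAC mulrA => /(mulIf (monic_neq0 (monicXn _ _))).
  by move/(congr1 (fun t : {poly P} => t`_e)); rewrite coefMC coefCM => ->.
move=> j; rewrite inE => /orP[/eqP->|/hpq[d' [hp hq]]].
  by exists e; split; exact: homog_in_coef_grade.
by exists d'; split=> N /msupp_coef_grade; [exact: hp|exact: hq].
Qed.

(** Numerator and denominator of a multihomogeneous fraction are divided by the
    same monomial in the first variables x_i0 of the arrays. *)
Lemma homog0_ratios (hn : (0 < n)%N) (L : K -> Prop) :
    is_subfield L -> (forall c, L (scal c)) ->
    (forall i j l, L (var i j / var i l)) ->
  forall f, homog0 f -> L f.
Proof.
move=> sfL Lk Lx f /multihomogeneous_fraction[p [q [q0 -> hpq]]].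
pose y i := var i (Ordinal hn).
have [d hd] := fin_all_exists hpq.
pose Y := \prod_i y i ^+ d i.
have Y0 : Y != 0 by rewrite prodf_seq_neq0; apply/allP => i _;
  rewrite expf_neq0 // var_neq0.
have Lhom (r : P) : (forall i, homog_in i (d i) r) -> L (tofrac r / Y).
  move=> hr; rewrite (mpolyE r) rmorph_sum mulr_suml big_seq.
  apply: subfield_sum => // M Mr; rewrite /= -mul_mpolyC tofracM -mulrA.
  apply: subfieldM => //; first exact: Lk.
  have -> : Y = \prod_l y (enum_val l).1 ^+ (M l).
    rewrite prod_vars; apply: eq_bigr => i _; rewrite -(hr _ _ Mr) /mdeg_in
      expr_sum.
    by apply: eq_bigr => j _; rewrite enum_rankK.
  rewrite tofracX -prodf_div; apply: subfield_prod => // l _.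
  by rewrite -expr_div_n; apply: subfieldX => //; exact: Lx.
have -> : tofrac p / tofrac q = (tofrac p / Y) / (tofrac q / Y).
  by rewrite invf_div mulrA divfK.
by apply: subfield_div => //; apply: Lhom => i; case: (hd i).
Qed.

Lemma homog_inD i d (p q : P) :
  homog_in i d p -> homog_in i d q -> homog_in i d (p + q).
Proof.
move=> hp hq M /msuppD_le; rewrite mem_cat => /orP[/hp|/hq] //.
Qed.

Lemma homog_inN i d (p : P) : homog_in i d p -> homog_in i d (- p).
Proof. by move=> hp M; rewrite (perm_mem (msuppN p)) => /hp. Qed.

Lemma mdeg_inD i (M N : 'X_{1..nvars m n}) :
  mdeg_in i (M + N) = (mdeg_in i M + mdeg_in i N)%N.
Proof.
by rewrite /mdeg_in -big_split; apply: eq_bigr => j _; rewrite mnmDE.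
Qed.

Lemma homog_inM i d e (p q : P) :
  homog_in i d p -> homog_in i e q -> homog_in i (d + e) (p * q).
Proof.
move=> hp hq M /msuppM_le /allpairsP[[N N'] /= [/hp <- /hq <- ->]].
exact: mdeg_inD.
Qed.

Lemma homog_in_const i (c : k) : homog_in i 0 (c%:MP : P).
Proof.
move=> M; rewrite msuppC; case: eqP => // _; rewrite inE => /eqP->.
by rewrite /mdeg_in big1 // => j _; rewrite mnm0E.
Qed.

Lemma homog0_subfield : is_subfield (@homog0 k m n).
Proof.
split=> [i|f g hf hg i|f g hf hg i|f hf i].
- by exists 0%N, 1, 1; split; rewrite ?oner_neq0 ?divr1 ?tofrac1 //;
    apply: homog_in_const.
- have [d [a [b [ha hb b0 ->]]]] := hf i; have [d' [a' [b' [ha' hb' b'0 ->]]]]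
    := hg i.
  exists (d + d')%N, (a * b' - a' * b), (b * b'); split.
  + apply: homog_inD; first exact: homog_inM.
    by apply: homog_inN; rewrite addnC; exact: homog_inM.
  + exact: homog_inM.
  + exact: mulf_neq0.
  + by rewrite -mulNr addf_div ?tofrac_eq0 // tofracD tofracN !tofracM mulNr.
- have [d [a [b [ha hb b0 ->]]]] := hf i; have [d' [a' [b' [ha' hb' b'0 ->]]]]
    := hg i.
  exists (d + d')%N, (a * a'), (b * b'); split;
    [exact: homog_inM|exact: homog_inM|exact: mulf_neq0|].
  by rewrite mulf_div !tofracM.
- have [d [a [b [ha hb b0 fab]]]] := hf i.
  have [f0|f0] := eqVneq f 0; first by rewrite f0 invr0 -f0.
  exists d, b, a; split=> //; last by rewrite fab invf_div.
  by apply: contraNneq f0 => a0; rewrite fab a0 tofrac0 mul0r.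
Qed.

Lemma homog0_scal c : homog0 (scal c : K).
Proof.
move=> i; exists 0%N, c%:MP, 1; split; rewrite ?oner_neq0 ?tofrac1 ?divr1 //.
  exact: homog_in_const.
exact: homog_in_const.
Qed.

Lemma homog0_ratio i j l : homog0 (var i j / var i l).
Proof.
move=> i'; exists (i == i' : nat), 'X_(enum_rank (i, j)), 'X_(enum_rank (i, l)).
have hX j' : homog_in i' (i == i') ('X_(enum_rank (i, j')) : P).
  move=> M; rewrite msuppX inE => /eqP->; rewrite /mdeg_in.
  under eq_bigr => j'' _ do rewrite mnm1E (inj_eq enum_rank_inj) xpair_eqE.
  have [_|_] /= := eqVneq i i'; last by rewrite big1.
  by rewrite (bigD1 j') //= eqxx big1 // => j'' /negPf; rewrite eq_sym => ->.
by split; [exact: hX|exact: hX|rewrite -msupp_eq0 msuppX|].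
Qed.

End Homogeneous.

(** * Relations between the ratios of the variables of an array *)

Section Roots.
Variables (k : fieldType) (m n : nat) (i1 : 'I_m).
Local Notation P := {mpoly k[nvars m n]}.
Local Notation K := (ratfun k m n).
Local Notation tofrac := (@FracField.tofrac (polys k m n)).
Local Notation y := (@var k m n i1).

Lemma prod_var_perm_eq (s s' : seq 'I_n) :
  \prod_(j <- s) y j = \prod_(j <- s') y j -> perm_eq s s'.
Proof.
pose M s : 'X_{1..nvars m n} :=
  [multinom count (fun j => enum_rank (i1, j) == l) s | l < nvars m n].
have yM u : \prod_(j <- u) y j = tofrac 'X_[M u].
  elim: u => [|j u IHu].
    rewrite big_nil (_ : M [::] = 0%MM) ?mpolyX0 ?tofrac1 //.
  have -> : M (j :: u) = (U_(enum_rank (i1, j)) + M u)%MM.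
    by apply/mnmP => l; rewrite mnmDE mnm1E !mnmE.
  by rewrite big_cons IHu mpolyXD tofracM.
rewrite !yM => /eqP; rewrite tofrac_eq => /eqP /(congr1 (fun p => head 0%MM
  (msupp p))).
rewrite !msuppX /= => eqM; apply/allP => j _; apply/eqP.
have /(congr1 (fun N : 'X_{1..nvars m n} => N (enum_rank (i1, j)))) := eqM.
rewrite !mnmE.
by congr (_ = _); apply: eq_count => j' /=;
  rewrite (inj_eq enum_rank_inj) xpair_eqE eqxx.
Qed.

Definition offdiag : finType := {a : 'I_n * 'I_n | a.1 != a.2}.

Definition coord_ratio (a : offdiag) : K := y (val a).1 / y (val a).2.

Lemma card_offdiag : #|offdiag| = (n * (n - 1))%N.
Proof.
rewrite card_sig.
have := cardC [pred a : 'I_n * 'I_n | a.1 == a.2].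
rewrite card_prod card_ord.
have -> : #|[pred a : 'I_n * 'I_n | a.1 == a.2]| = n.
  rewrite -[RHS]card_ord -(card_imset _ (_ :
    injective (fun j : 'I_n => (j, j)))).
    apply: eq_card => -[j l]; rewrite inE /=; apply/eqP/imsetP =>
      [->|[j' _ [-> ->]]] //.
    by exists l.
  by move=> j l [].
rewrite mulnBr muln1 => <-; rewrite addKn; exact: eq_card.
Qed.

Lemma coord_ratio_inj : injective coord_ratio.
Proof.
move=> [[a a'] /= aa'] [[b b'] /= bb'] /eqP.
rewrite /coord_ratio /= eqr_div ?var_neq0 // => /eqP eqab.
have := @prod_var_perm_eq [:: a; b'] [:: b; a'].
rewrite !big_cons !big_nil !mulr1 => /(_ eqab) peq.
have ab : a = b.
  have := perm_mem peq a; rewrite !inE eqxx (negPf aa') orbF /=.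
  by move/esym/eqP.
apply: val_inj => /=; congr (_, _) => //; move: peq.
by rewrite ab perm_cons => /perm_mem /(_ b'); rewrite !inE eqxx => /esym/eqP.
Qed.

Lemma coord_ratio_neq0 a : coord_ratio a != 0.
Proof. by rewrite mulf_neq0 ?invr_neq0 ?var_neq0. Qed.

(** In the root system A_(n-1), a difference of two roots is a root only if they
    have the same source or the same target. *)
Lemma share_end (a b c : offdiag) :
  coord_ratio a = coord_ratio b * coord_ratio c ->
  ((val a).1 == (val b).1) || ((val a).2 == (val b).2).
Proof.
case: a b c => [[a a'] /= aa'] [[b b'] /= bb'] [[c c'] /= cc'] /eqP.
rewrite /coord_ratio /= mulf_div eqr_div ?mulf_neq0 ?var_neq0 // => /eqP eqabc.
have := @prod_var_perm_eq [:: a; b'; c'] [:: b; c; a'].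
rewrite !big_cons !big_nil !mulr1 eqabc mulrA => /(_ erefl) peq.
have := perm_mem peq a; rewrite !inE eqxx (negPf aa') orbF /=.
have [//|nab /= /esym/eqP ac] := eqVneq a b; move: peq.
rewrite -ac -[X in perm_eq _ X]/([:: b] ++ [:: a] ++ [:: a']) perm_sym
  perm_catCA perm_cons.
move/perm_mem/(_ b'); rewrite !inE eqxx /= eq_sym (negPf bb') /=.
by rewrite eq_sym.
Qed.

Hypothesis hn : (0 < n)%N.

Lemma unit_ext_insub j l :
  unit_ext coord_ratio (insub (j, l)) = y j / y l.
Proof.
case: insubP => [u _ uE|]; first by rewrite /= /coord_ratio uE.
by rewrite negbK => /eqP /= ->; rewrite divff ?var_neq0.
Qed.

(** Automorphisms of the root system A_(n-1).  The images of the pairs (j0, l)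
    have pairwise a common first or a common second coordinate; hence all of
    them have the same first coordinate, or all have the same second one.  The
    other coordinates define the permutation s, and multiplicativity determines
    the images of the remaining pairs. *)
Lemma preserves_ratio (r : {ffun offdiag -> offdiag}) :
  preserves coord_ratio r ->
  exists s : 'S_n,
     (forall a, coord_ratio (r a) = y (s (val a).1) / y (s (val a).2)) \/
     (forall a, coord_ratio (r a) = y (s (val a).2) / y (s (val a).1)).
Proof.
move=> hr; have injr := preserves_inj coord_ratio_inj hr;
  move/preservesE: hr => hr.
pose j0 := Ordinal hn.
pose w j l := unit_ext coord_ratio (omap r (insub (j, l))).
have cocycle j l o : w j l * w l o = w j o.
  apply/eqP; have := hr (insub (j, l), insub (l, o), insub (j, o)).
  by rewrite /holds_at /= !unit_ext_insub => ->; rewrite mulrA divfK ?var_neq0.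
have w_neq0 j l : w j l != 0.
  by rewrite /w; case: insubP => [u _ _|_] /=; rewrite ?coord_ratio_neq0
    ?oner_neq0.
have wE j l : w j l = w j0 l / w j0 j.
  by rewrite -(cocycle j0 j l) mulrAC divff ?mul1r.
have w_arc a : coord_ratio (r a) = w (val a).1 (val a).2.
  by rewrite /w -surjective_pairing valK.
(* without an index other than j0, i.e. for n = 1, there are no pairs *)
have [l1 l1j0|no_l] := pickP (fun l => l != j0); last first.
  exists 1%g; left=> a; have := valP a.
  by rewrite (eqP (negbFE (no_l (val a).1))) (eqP (negbFE (no_l (val a).2)))
    eqxx.
have ne_l1 : (j0, l1).1 != (j0, l1).2 by rewrite eq_sym.
pose b1 : offdiag := Sub (j0, l1) ne_l1.
(* image of the pair (j0, l); the default value is only met at l = j0 *)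
pose star l := oapp r (r b1) (insub (j0, l)).
have starE l : l != j0 -> w j0 l = coord_ratio (star l).
  by move=> lj; rewrite /w /star; case: insubP => //=;
    rewrite negbK eq_sym (negPf lj).
have star_inj l l' : l != j0 -> l' != j0 -> star l = star l' -> l = l'.
  rewrite /star => lj l'j.
  case: insubP => [u _ uE|]; last by rewrite negbK eq_sym (negPf lj).
  case: insubP => [u' _ u'E|]; last by rewrite negbK eq_sym (negPf l'j).
  by move=> /= /injr uu'; move: uE; rewrite uu' u'E => -[].
have share l l' : l != j0 -> l' != j0 -> l != l' ->
    ((val (star l)).1 == (val (star l')).1) ||
    ((val (star l)).2 == (val (star l')).2).
  move=> lj l'j ll'; have ne : (l', l).1 != (l', l).2 by rewrite eq_sym.
  apply: (@share_end _ _ (r (Sub (l', l) ne))).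
  by rewrite -!starE // w_arc /= cocycle.
case: (boolP [forall l, (l != j0) ==> ((val (star l)).1 == (val (star l1)).1)]).
  move/forallP=> src.
  have srcE l : l != j0 -> (val (star l)).1 = (val (star l1)).1.
    by have /implyP := src l => h /h /eqP.
  (* j0 goes to the common source, l to the target of the image of (j0, l) *)
  pose g l := if l == j0 then (val (star l1)).1 else (val (star l)).2.
  have ginj : injective g.
    move=> l l'; rewrite /g.
    have [->|lj] := eqVneq l j0; have [->|l'j] := eqVneq l' j0 => //.
    - by move=> e; have := valP (star l'); rewrite srcE // e eqxx.
    - by move=> e; have := valP (star l); rewrite srcE // e eqxx.
    - move=> e; apply: star_inj => //; apply: val_inj.
      by rewrite [LHS]surjective_pairing [RHS]surjective_pairing !srcE // e.
  exists (perm ginj); left=> a; rewrite !permE.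
  have wg l : w j0 l = y (g j0) / y (g l).
    rewrite /g eqxx; have [->|lj] := eqVneq l j0.
      by rewrite divff ?var_neq0 // /w insubF //= eqxx.
    by rewrite starE // /coord_ratio srcE.
  by rewrite w_arc wE !wg invf_div mulrC mulrA divfK ?var_neq0.
rewrite negb_forall => /existsP[l2]; rewrite negb_imply => /andP[l2j ne12].
have l12 : l2 != l1 by apply: contraNneq ne12 => ->.
have tgt12 : (val (star l2)).2 = (val (star l1)).2.
  by have := share _ _ l2j l1j0 l12; rewrite (negPf ne12) => /eqP.
have tgtE l : l != j0 -> (val (star l)).2 = (val (star l1)).2.
  move=> lj; have [->//|ll1] := eqVneq l l1.
  have /orP[/eqP e1|/eqP//] := share _ _ lj l1j0 ll1.
  have [->//|ll2] := eqVneq l l2.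
  have /orP[|/eqP->//] := share _ _ lj l2j ll2.
  by rewrite e1 eq_sym (negPf ne12).
pose g l := if l == j0 then (val (star l1)).2 else (val (star l)).1.
have ginj : injective g.
  move=> l l'; rewrite /g.
  have [->|lj] := eqVneq l j0; have [->|l'j] := eqVneq l' j0 => //.
  - by move=> e; have := valP (star l'); rewrite tgtE // e eqxx.
  - by move=> e; have := valP (star l); rewrite tgtE // e eqxx.
  - move=> e; apply: star_inj => //; apply: val_inj.
    by rewrite [LHS]surjective_pairing [RHS]surjective_pairing !tgtE // e.
exists (perm ginj); right=> a; rewrite !permE.
have wg l : w j0 l = y (g l) / y (g j0).
  rewrite /g eqxx; have [->|lj] := eqVneq l j0.
    by rewrite divff ?var_neq0 // /w insubF //= eqxx.
  by rewrite starE // /coord_ratio tgtE.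
by rewrite w_arc wE !wg invf_div mulrA divfK ?var_neq0.
Qed.

End Roots.

(** * The action of G and the generators *)

Section Action.
Variables (k : fieldType) (m n : nat).
Local Notation K := (ratfun k m n).
Local Notation x := (@var k m n).
Local Notation scal := (@scal k m n).

Lemma generated_subfield (S : K -> Prop) : is_subfield (generated S).
Proof.
split=> [|f g Sf Sg||].
- by rewrite -(rmorph1 scal); exact: gen_scal.
- by apply: gen_add => //; exact: gen_opp.
- exact: gen_mul.
- exact: gen_inv.
Qed.

Lemma gact_rmorphism (g : 'S_n * bool) :
  exists h : {rmorphism K -> K}, gact g =1 h.
Proof.
case: g => s []; first by exists (@tau k m n \o sigma s).
by exists (sigma s).
Qed.

Lemma gact_scal (g : 'S_n * bool) c : gact g (scal c) = scal c.
Proof. by rewrite /gact; case: ifP => _; rewrite sigma_scal ?tau_scal. Qed.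

Lemma gact_var (g : 'S_n * bool) i j :
  gact g (x i j) = if g.2 then (x i (g.1 j))^-1 else x i (g.1 j).
Proof. by rewrite /gact; case: ifP => _; rewrite sigma_var ?tau_var. Qed.

(** A permutation reindexes both traces, and tau exchanges them. *)
Lemma gact_trace_pair (g : 'S_n * bool) (v : 'I_n -> K) :
    (forall j, gact g (v j) = if g.2 then (v (g.1 j))^-1 else v (g.1 j)) ->
  gact g (tr v * tr (fun j => (v j)^-1)) = tr v * tr (fun j => (v j)^-1).
Proof.
have [h hE] := gact_rmorphism g.
move=> hv; rewrite hE rmorphM !rmorph_sum /=.
have hv' j : h (v j) = if g.2 then (v (g.1 j))^-1 else v (g.1 j) by rewrite -hE.
case: g hv' {hE hv} => s b /= hv.
under eq_bigr do rewrite hv.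
under [X in _ * X]eq_bigr do rewrite fmorphV hv.
have sumE (w : 'I_n -> K) : \sum_j w (s j) = \sum_j w j.
  by rewrite [RHS](reindex_inj (@perm_inj _ s)).
rewrite (sumE (fun j => if b then (v j)^-1 else v j)).
rewrite (sumE (fun j => (if b then (v j)^-1 else v j)^-1)).
case: b {hv} => //.
by under [X in _ * X]eq_bigr do rewrite invrK; rewrite mulrC.
Qed.

Lemma trace_pairE (v : 'I_n -> K) : (forall j, v j != 0) ->
  tr v * tr (fun j => (v j)^-1) =
  n%:R + \sum_(a : offdiag n) v (val a).1 / v (val a).2.
Proof.
move=> v0; rewrite /tr big_distrlr /=.
under eq_bigr => j _ do rewrite (bigD1 j) //= divff //.
rewrite big_split /= sumr_const card_ord; congr (_ + _).
rewrite pair_big_dep /= (reindex_omap (val : offdiag n -> _) insub) /=;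
  last first.
  by move=> [j l] /=; rewrite eq_sym => jl; rewrite insubT.
by apply: eq_bigl => a; rewrite valK eqxx andbT eq_sym (valP a).
Qed.

Lemma homog0_trace_pair (v : 'I_n -> K) :
    (forall j l, homog0 (v j / v l)) -> homog0 (tr v * tr (fun j => (v j)^-1)).
Proof.
move=> hv; rewrite /tr big_distrlr /=; have sf := @homog0_subfield k m n.
by apply: subfield_sum => // j _; apply: subfield_sum => // l _; exact: hv.
Qed.

Lemma preserves_gact (hn : (0 < n)%N) i1 (r : {ffun offdiag n -> offdiag n}) :
    preserves (@coord_ratio k m n i1) r ->
  exists g, forall a, gact g (coord_ratio k i1 a) = coord_ratio k i1 (r a).
Proof.
have gactE (g : 'S_n * bool) a : gact g (coord_ratio k i1 a) =
    gact g (x i1 (val a).1) / gact g (x i1 (val a).2).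
  by have [h hE] := gact_rmorphism g; rewrite !hE fmorph_div.
case/(preserves_ratio hn) => s [rE|rE];
  [exists (s, false)|exists (s, true)] => a.
  by rewrite gactE !gact_var rE.
by rewrite gactE !gact_var rE /= invrK mulrC.
Qed.

Lemma pchar_ratfun : [pchar k] =i pred0 -> [pchar K] =i pred0.
Proof. by move=> hk p; rewrite -hk -(fmorph_pchar scal). Qed.

End Action.

Theorem theorem6p1 (k : fieldType) (hk : [pchar k] =i pred0)
    (m n : nat) (hm : (1 <= m)%N) (hn : (1 <= n)%N) :
  let x : 'I_m -> 'I_n -> ratfun k m n := @var k m n in
  let i1 : 'I_m := Ordinal hm in
  let q (r : nat) : ratfun k m n :=
    tr (fun j => x i1 j ^+ r) * tr (fun j => x i1 j ^- r) in
  let q' (i : 'I_m) (s : nat) : ratfun k m n :=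
    tr (fun j => x i1 j ^+ s * x i j) *
    tr (fun j => x i1 j ^- s * (x i j)^-1) in
  forall f : ratfun k m n,
    homog0 f /\ Ginvariant f <->
    generated (fun g : ratfun k m n =>
      (exists r : nat,
         [/\ (1 <= r)%N, (r <= (n * (n - 1)) %/ 2)%N & g = q r]) \/
      (exists (i : 'I_m) (s : nat),
         [/\ i != i1, (s < n * (n - 1))%N & g = q' i s])) f.
Proof.
move=> x i1 q q' f.
have q'E i s : q' i s = tr (fun j => x i1 j ^+ s * x i j) *
                        tr (fun j => (x i1 j ^+ s * x i j)^-1).
  by congr (_ * _); apply: eq_bigr => j _; rewrite invfM.
set S := fun g => _ \/ _.
have invF g : generated S g -> homog0 g /\ Ginvariant g.
  have sf0 := @homog0_subfield k m n.
  elim=> {g} [g|c|g h _ [g0 gG] _ [h0 hG]|g _ [g0 gG]|g h _ [g0 gG] _ [h0 hG]|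
    g _ [g0 gG]].
  - case=> [[r [_ _ ->]]|[i [s [_ _ ->]]]].
      split.
        apply: (@homog0_trace_pair k m n (fun j => x i1 j ^+ r)) => j l;
          rewrite -expr_div_n.
        by apply: (@subfieldX _ _ sf0); exact: homog0_ratio.
      move=> s'; apply: (@gact_trace_pair k m n s' (fun j => x i1 j ^+ r)) => j.
      have [e eE] := gact_rmorphism k m s'.
      by rewrite eE rmorphXn -eE gact_var; case: ifP => _ //; rewrite exprVn.
    rewrite q'E; split.
      apply: (@homog0_trace_pair k m n (fun j => x i1 j ^+ s * x i j)) => j l;
        rewrite -mulf_div -expr_div_n.
      apply: (@subfieldM _ _ sf0); last exact: homog0_ratio.
      by apply: (@subfieldX _ _ sf0); exact: homog0_ratio.
    move=> s'; apply: (@gact_trace_pair k m n s' (fun j =>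
      x i1 j ^+ s * x i j)) => j.
    have [e eE] := gact_rmorphism k m s'.
    rewrite eE rmorphM rmorphXn -!eE !gact_var; case: ifP => _ //.
    by rewrite exprVn invfM.
  - by split; [exact: homog0_scal|move=> s'; exact: gact_scal].
  - split; first exact: (@subfieldD _ _ sf0).
    by move=> s'; have [e eE] := gact_rmorphism k m s';
      rewrite eE rmorphD -!eE gG hG.
  - split; first exact: (@subfieldN _ _ sf0).
    by move=> s'; have [e eE] := gact_rmorphism k m s';
      rewrite eE rmorphN -!eE gG.
  - split; first exact: (@subfieldM _ _ sf0).
    by move=> s'; have [e eE] := gact_rmorphism k m s';
      rewrite eE rmorphM -!eE gG hG.
  - split; first exact: (@subfieldV _ _ sf0).
    by move=> s'; have [e eE] := gact_rmorphism k m s';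
      rewrite eE fmorphV -!eE gG.
split=> [[f0 fG]|]; last exact: invF.
have sfF := generated_subfield S.
have Fn : generated S n%:R by apply: subfieldMn => //; exact: subfield1.
have card_offdiagE := card_offdiag n.
pose t := @coord_ratio k m n i1.
have injt : injective t by exact: coord_ratio_inj.
have char0 := @pchar_ratfun k m n hk.
pose flip (a : offdiag n) : offdiag n :=
  Sub ((val a).2, (val a).1) (etrans (congr1 negb (eq_sym _ _)) (valP a)).
have flipK : involutive flip by move=> a; apply: val_inj;
  rewrite [RHS]surjective_pairing.
have tflip a : t (flip a) = (t a)^-1 by rewrite /t /coord_ratio invf_div.
have F_power_sum r : generated S (power_sum t r).
  apply: (F_power_sum_all flipK tflip (@coord_ratio_neq0 _ _ _ _) sfF char0) =>
    {}r r1 rN.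
  have -> : power_sum t r = q r - n%:R.
    rewrite /q trace_pairE => [|j]; last by rewrite expf_neq0 ?var_neq0.
    by rewrite addrC addKr; apply: eq_bigr => a _; rewrite -expr_div_n.
  apply: subfieldB => //; apply: gen_mem; left; exists r.
  by rewrite -card_offdiagE.
pose L := root_ratio (generated S) t.
have sfL : is_subfield L by exact: root_ratio_subfield.
have FL g : generated S g -> L g by exact: root_ratio_sub.
have Lt a : L (t a) by exact: root_ratio_root.
(* the first array gives the family t itself, the others are interpolated *)
have Lx i j l : L (x i j / x i l).
  have [->|jl] := eqVneq j l; first by rewrite divff ?var_neq0 //;
    exact: subfield1.
  have [->|ii1] := eqVneq i i1; first by have := Lt (Sub (j, l) jl).
  pose u (a : offdiag n) := x i (val a).1 / x i (val a).2.
  apply: (subfield_interpolation (u := u) sfL injt Lt _ (Sub (j, l) jl)) => s.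
  rewrite card_offdiagE => sN; apply: FL.
  have -> : \sum_a t a ^+ s * u a = q' i s - n%:R.
    rewrite q'E trace_pairE => [|j']; last by rewrite mulf_neq0 ?expf_neq0
      ?var_neq0.
    rewrite addrC addKr; apply: eq_bigr => a _.
    by rewrite -mulf_div -expr_div_n.
  by apply: subfieldB => //; apply: gen_mem; right; exists i, s.
have Lf : L f.
  by apply: (homog0_ratios hn sfL) => // c; apply: FL; exact: gen_scal.
apply: (descent sfF F_power_sum injt char0 _ Lf) => r /(preserves_gact hn)[g
  gE].
have [h hE] := gact_rmorphism k m g.
exists h; split=> [c Fc|a|]; rewrite -?hE //.
by have [_] := invF c Fc; apply.
Qed.
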